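(* Let $\varphi\in[0,2\pi)$, $j,k\in\mathbb{C}$, $k\neq0$, and $L_s=jI+k\,SWAP_\varphi$, where $$SWAP_\varphi=|00\rangle\langle00|+e^{-i\varphi}|01\rangle\langle10|+e^{i\varphi}|10\rangle\langle01|+|11\rangle\langle11| .$$ Let $|\psi_1\rangle=\frac1{\sqrt2}(|01\rangle+e^{i\varphi}|10\rangle)$, $|\psi_2\rangle=\frac1{\sqrt2}(|01\rangle-e^{i\varphi}|10\rangle)$. Then the attractor space of the semigroup generated by $L_s$ and $H$ is ten-dimensional and equals $$\mathrm{span}\{|00\rangle\langle00|,|\psi_1\rangle\langle\psi_1|,|\psi_2\rangle\langle\psi_2|,|11\rangle\langle11|,|00\rangle\langle\psi_1|,|\psi_1\rangle\langle00|,|11\rangle\langle\psi_1|,|\psi_1\rangle\langle11|,|00\rangle\langle11|,|11\rangle\langle00|\},$$ and for every initial state $\rho(0)$ the asymptotic dynamics is $$\rho_{as}(t)=e^{-iHt}P_S\rho(0)P_Se^{iHt}+\langle\psi_2|\rho(0)|\psi_2\rangle\,|\psi_2\rangle\langle\psi_2|,$$ where $P_S$ is the orthogonal projection onto $\mathrm{span}\{|00\rangle,|\psi_1\rangle,|11\rangle\}$.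
   Context: Hilbert space $\mathbb{C}^2\otimes\mathbb{C}^2$, $|ij\rangle=|i\rangle\otimes|j\rangle$. $H=H_0\otimes I+I\otimes H_0$ with $H_0=\mathrm{diag}(E_0,E_1)$, $E_0,E_1\in\mathbb{R}$, $\Delta E=E_0-E_1\neq0$. The generator is $\mathcal L(\rho)=-i[H,\rho]+L_s\rho L_s^\dagger-\frac12\{L_s^\dagger L_s,\rho\}$, $\mathcal T_t=e^{t\mathcal L}$. The attractor space is the direct sum of $\ker(\mathcal L-\lambda I)$ over all purely imaginary eigenvalues $\lambda$ (including $0$) of $\mathcal L$. The asymptotic dynamics of $\rho(t)=\mathcal T_t(\rho(0))$ is the trajectory $\rho_{as}(t)=\mathcal T_t(\rho_{as}(0))$ inside the attractor space with $\lim_{t\to\infty}\|\rho(t)-\rho_{as}(t)\|=0$. *)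

(* Defs.v *)
From HB Require Import structures.
From mathcomp Require Import all_boot all_order all_algebra.
From mathcomp Require Import ring.
From mathcomp Require Import all_classical all_reals all_analysis.
From mathcomp Require Export complex mxtens spectral sesquilinear.
Import Order.TTheory GRing.Theory Num.Theory numFieldNormedType.Exports.

Set Implicit Arguments.
Unset Strict Implicit.
Unset Printing Implicit Defensive.

Local Open Scope classical_set_scope.
Local Open Scope ring_scope.
Local Open Scope sesquilinear_scope.
Local Open Scope complex_scope.

(* [R[i]] packaged as a [numClosedFieldType], so that the norm topology which
   mathcomp-analysis puts on every [numFieldType] is inferred for it. *)
Definition Cplx (R : realType) : numClosedFieldType := R[i].
Arguments Cplx R : simpl never.

Definition cplx_of (R : realType) (x : R) : Cplx R := x%:C.

Definition expi (R : realType) (x : R) : Cplx R := cos x +i* sin x.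

Section Exponential.
Context {K : numFieldType} {n : nat}.

Definition expmx (A : 'M[K]_n.+1) : 'M[K]_n.+1 :=
  lim (series (fun m => (m`!%:R)^-1 *: A ^+ m) @ \oo).

(* [e^F X] for a superoperator [F]. *)
Definition expsup (F : 'End('M[K]_n.+1)) (X : 'M[K]_n.+1) : 'M[K]_n.+1 :=
  lim (series (fun m => (m`!%:R)^-1 *: iter m F X) @ \oo).

End Exponential.

Section Generator.
Context {K : numClosedFieldType} {n : nat}.
Implicit Types H Ls X rho : 'M[K]_n.

Definition lindblad_fun H Ls X : 'M[K]_n :=
  - 'i *: (H *m X - X *m H) + Ls *m X *m Ls^t*
  - 2^-1 *: (Ls^t* *m Ls *m X + X *m (Ls^t* *m Ls)).

Fact lindblad_fun_linear H Ls : linear (lindblad_fun H Ls).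
Proof.
move=> a X Y; rewrite /lindblad_fun !mulmxDr !mulmxDl.
rewrite -!scalemxAl -!scalemxAr -!scalemxAl.
rewrite !(scalerDr, scalerBr, opprD, scalerN) !scalerA ![a * _]mulrC.
by apply/matrixP=> i j; rewrite !mxE; ring.
Qed.

HB.instance Definition _ H Ls :=
  GRing.isLinear.Build K 'M[K]_n 'M[K]_n *:%R (lindblad_fun H Ls)
    (lindblad_fun_linear H Ls).

Definition lindblad H Ls : 'End('M[K]_n) := linfun (lindblad_fun H Ls).

(* The index set is finite, hence so is the support of this sum of
   eigenspaces; the sum of eigenspaces for distinct eigenvalues is direct. *)
Definition attractor (F : 'End('M[K]_n)) : {vspace 'M[K]_n} :=
  \big[addv/0%VS]_(l \in [set l : K | passmx.leigenvalue F l /\ 'Re l = 0])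
    passmx.leigenspace F l.

Definition density rho : Prop :=
  [/\ rho \is hermsymmx,
      forall v : 'cV[K]_n, 0 <= (v^t* *m rho *m v) 0 0 & \tr rho = 1].

Definition ketbra (a b : 'cV[K]_n) : 'M[K]_n := a *m b^t*.

(* Orthogonal projection onto the column space of [U], acting on column
   vectors; [proj_ortho] is stated for row spaces and acts on row vectors. *)
Definition orthoproj {p} (U : 'M[K]_(n, p)) : 'M[K]_n := (proj_ortho U^T)^T.

End Generator.

Section Dynamics.
Context {R : realType} {n : nat}.
Local Notation C := (Cplx R).

Definition semigroup (F : 'End('M[C]_n.+1)) (t : R) :
    'M[C]_n.+1 -> 'M[C]_n.+1 :=
  expsup (cplx_of t *: F).

Definition asymptotic_dynamics (F : 'End('M[C]_n.+1)) (rho0 : 'M[C]_n.+1)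
    (rho_as : R -> 'M[C]_n.+1) : Prop :=
  [/\ forall t, 0 <= t -> rho_as t \in attractor F,
      forall t, 0 <= t -> rho_as t = semigroup F t (rho_as 0) &
      (fun t => `|semigroup F t rho0 - rho_as t|) @ +oo --> (0 : C)].

End Dynamics.

Section TwoQubits.
Context {R : realType}.
Local Notation C := (Cplx R).

(* The library types the tensor products below by ['M_(2 * 2)] and
   ['M_(2 * 2, 1 * 1)], which are convertible to ['M_4] and ['cV_4]. *)
Definition ket (i j : 'I_2) : 'cV[C]_4 :=
  (delta_mx i 0 : 'cV[C]_2) *t (delta_mx j 0 : 'cV[C]_2).

Definition H0 (E0 E1 : R) : 'M[C]_2 :=
  diag_mx (\row_(i < 2) cplx_of (if i == 0 then E0 else E1)).

Definition hamiltonian (E0 E1 : R) : 'M[C]_4 :=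
  H0 E0 E1 *t (1%:M : 'M[C]_2) + (1%:M : 'M[C]_2) *t H0 E0 E1.

Definition swap (phi : R) : 'M[C]_4 :=
  ketbra (ket 0 0) (ket 0 0) + expi (- phi) *: ketbra (ket 0 1) (ket 1 0)
  + expi phi *: ketbra (ket 1 0) (ket 0 1) + ketbra (ket 1 1) (ket 1 1).

Definition psi1 (phi : R) : 'cV[C]_4 :=
  (sqrtC 2)^-1 *: (ket 0 1 + expi phi *: ket 1 0).

Definition psi2 (phi : R) : 'cV[C]_4 :=
  (sqrtC 2)^-1 *: (ket 0 1 - expi phi *: ket 1 0).

End TwoQubits.

(* Main.v *)
(** The swap-type operator is [I - 2 |psi2><psi2|] and commutes with [H], so the
    orthonormal basis [e] = (|00>, psi1, psi2, |11>) diagonalises both [H] and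
    [L_s]; hence the sixteen operators [|e_a><e_b|] are eigenvectors of the
    generator, with eigenvalues whose real part is [- |l_a - l_b|^2 / 2] when
    [L_s e_a = l_a e_a].  This vanishes exactly when [a] and [b] are both equal
    to, or both different from, the index of psi2, which leaves 1 + 9 attractor
    directions.  The other coefficients decay exponentially, and a trajectory
    inside the attractor space is determined by its distance to [rho(t)] tending
    to 0, since its coefficients have constant modulus. *)
From HB Require Import structures.
Require Import Defs.
From mathcomp Require Import all_boot all_order all_algebra.
From mathcomp Require Import ring.
From mathcomp Require Import all_classical all_reals all_analysis.
Import Order.TTheory GRing.Theory Num.Theory numFieldNormedType.Exports.
Set Implicit Arguments.
Unset Strict Implicit.
Unset Printing Implicit Defensive.

Local Open Scope ring_scope.
Local Open Scope sesquilinear_scope.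

(** * The complex exponential *)

Section ComplexExponential.
Local Open Scope classical_set_scope.
Local Open Scope complex_scope.
Context {R : realType}.
Local Notation C := (Cplx R).
Local Notation normc := (@ComplexField.Normc.normc R).

Lemma cplx_of_norm (x : R) : `|cplx_of x| = cplx_of `|x| :> C.
Proof. by rewrite /cplx_of normc_def /= expr0n addr0 sqrtr_sqr. Qed.

Lemma cplx_of_continuous : continuous (@cplx_of R).
Proof.
move=> x; apply/cvgrPdist_lt => e e0.
(* The radius [e] is a complex number; being positive in the order of [C] forces it to be real,
   which reduces the claim to the topology of [R]. *)
have [Ie Re] : complex.Im e = 0 /\ 0 < complex.Re e.
  by move: e0; rewrite ltcE /= => /andP[/eqP].
have eE : e = cplx_of (complex.Re e) by apply/eqP; rewrite eq_complex /= Ie !eqxx.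
near=> y.
rewrite /cplx_of -rmorphB/= -/(cplx_of _) cplx_of_norm eE ltcR.
by near: y; apply: cvgr_dist_lt => //; exact: cvg_id.
Unshelve. all: by end_near. Qed.

Lemma cvg_cplx (T : Type) (F : set_system T) (FF : Filter F) (u v : T -> R) (a b : R) :
  u @ F --> a -> v @ F --> b ->
  (fun t => (u t +i* v t : C)) @ F --> (a +i* b : C).
Proof.
move=> ua vb.
have E x y : (x +i* y : C) = cplx_of x + 'i * cplx_of y.
  by rewrite -complexiE /cplx_of; simpc.
rewrite (_ : (fun t => _) = fun t => cplx_of (u t) + 'i * cplx_of (v t)); last first.
  by apply/funext => t; rewrite E.
rewrite E; apply: cvgD; first exact: (continuous_cvg _ (@cplx_of_continuous a) ua).
by apply: cvgMr; exact: (continuous_cvg _ (@cplx_of_continuous b) vb).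
Qed.

(** Closed form of the exponential, so that addition law and modulus come from [expR], [cos] and
    [sin]; [cvg_exp_series] identifies it with the power series. *)
Definition cexp (z : C) : C := cplx_of (expR (complex.Re z)) * expi (complex.Im z).

(** * The exponential power series, through real power series in a time variable *)

Section Series.
Variable z : C.
Let c (w : C) (m : nat) : R := complex.Re (w * z ^+ m : C) / m`!%:R.

(** The factorial absorbs the factor produced by differentiation, so differentiating amounts to
    replacing [w] by [w * z]. *)
Let c_diffs w : pseries_diffs (c w) = c (w * z).
Proof.
apply/funext => m; rewrite /pseries_diffs /c factS natrM invfM exprS mulrCA.
by rewrite mulVKf ?pnatr_eq0 // mulrA.
Qed.

(** Absolute convergence, by comparison with [normc w] times the real exponential series at
    [normc z * |x|]. *)
Let is_cvg_c w x : cvgn (pseries (c w) x).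
Proof.
apply: normed_cvg; rewrite /normed_series_of.
have N0 (u : C) : 0 <= normc u by case: u => a b; rewrite /= sqrtr_ge0.
have : cvgn (series (fun m => normc w * exp_coeff (normc z * `|x|) m)).
  exact: (@is_cvg_seriesZ R _ (normc w) (is_cvg_series_exp_coeff (normc z * `|x|))).
apply: series_le_cvg => [n|n|n] /=; first exact: normr_ge0.
  by rewrite mulr_ge0 ?divr_ge0 ?exprn_ge0 ?mulr_ge0.
rewrite /c /exp_coeff /= normrM normrX normrM normfV.
have Re_le (u : C) : `|complex.Re u| <= normc u by rewrite -lecR normc_ge_Re.
rewrite [leRHS](_ : _ = normc (w * z ^+ n) / `|n`!%:R| * `|x| ^+ n); last first.
  have -> : normc (w * z ^+ n) = normc w * normc z ^+ n.
    rewrite ComplexField.Normc.normcM; congr (_ * _).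
    elim: n => [|n IH]; first by rewrite !expr0 ComplexField.Normc.normc1.
    by rewrite !exprS ComplexField.Normc.normcM IH.
  by rewrite normr_nat exprMn; ring.
by rewrite ler_wpM2r ?exprn_ge0// ler_wpM2r ?invr_ge0.
Qed.

(* [f w t] is the real part of [w e^(tz)]; with [w = 1] and [w = -i] this gives
   the real and imaginary parts of [e^(tz)]. *)
Let f (w : C) (x : R) : R := limn (pseries (c w) x).

Let f_derive (w : C) (x : R) : is_derive x (1 : R) (f w) (f (w * z) x).
Proof.
rewrite /f -c_diffs; apply: (@pseries_snd_diffs _ _ (`|x| + 1)).
- exact: is_cvg_c.
- by rewrite c_diffs.
- by rewrite !c_diffs.
- by rewrite [ltRHS]ger0_norm ?addr_ge0 // ltrDl.
Qed.

Let f0 (w : C) : f w 0 = complex.Re w.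
Proof.
apply: lim_near_cst => //; near=> n.
(* The constant term is present only in nonempty partial sums, so [n = 0] is excluded. *)
have -> : n = n.-1.+1 by rewrite prednK //; near: n; exists 1%N.
rewrite /pseries /series /= big_nat_recl // big1 ?addr0 => [|i _].
  by rewrite /c fact0 !expr0 divr1 !mulr1.
by rewrite exprS mul0r mulr0.
Unshelve. all: by end_near. Qed.

(** Since [z] and [-i z] are real combinations of [1] and [-i], this turns the derivatives of [F]
    and [G] below into a closed linear system. *)
Let fD (w w' : C) (x a b : R) :
  f (cplx_of a * w + cplx_of b * w') x = a * f w x + b * f w' x.
Proof.
rewrite /f; apply: cvg_lim => //.
rewrite (_ : pseries _ _ = (fun n => a * pseries (c w) x n + b * pseries (c w') x n)).
  by apply: cvgD; apply: cvgMr; exact: is_cvg_c.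
apply/funext => n; rewrite /pseries /series /= !mulr_sumr -big_split /=.
apply: eq_bigr => i _; rewrite /c /cplx_of mulrDl raddfD/= -!mulrA.
have H (r : R) (u : C) : complex.Re (r%:C * u : C) = r * complex.Re u.
  by case: u => ? ?; simpc.
by rewrite !H; ring.
Qed.

Let x : R := complex.Re z.
Let y : R := complex.Im z.
Let F : R -> R := f 1.
Let G : R -> R := f (0 -i* 1).

Let F_derive (t : R) : is_derive t (1 : R) F (x * F t - y * G t).
Proof.
rewrite -mulNr -fD /F.
suff -> : cplx_of x * 1 + cplx_of (- y) * (0 -i* 1) = 1 * z :> C by apply: f_derive.
by rewrite /x /y /cplx_of; case: z => a b; simpc.
Qed.

Let G_derive (t : R) : is_derive t (1 : R) G (x * G t + y * F t).
Proof.
rewrite -fD /F.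
suff -> : cplx_of x * (0 -i* 1) + cplx_of y * 1 = (0 -i* 1) * z :> C by apply: f_derive.
by rewrite /x /y /cplx_of; case: z => a b; simpc.
Qed.

(* [e^(-tz) (F t + i G t)] has zero derivative. *)
Let cst1 t : expR (- (x * t)) * (cos (y * t) * F t + sin (y * t) * G t) = 1.
Proof.
set g := fun t => expR (- (x * t)) * (cos (y * t) * F t + sin (y * t) * G t).
rewrite -/(g t) (_ : g t = g 0); last first.
  apply: is_derive_0_is_cst => {}t.
  have DF := F_derive t; have DG := G_derive t; rewrite /g.
  by apply: trigger_derive; rewrite /GRing.scale /=; ring.
by rewrite /g !mulr0 oppr0 expR0 cos0 sin0 /F f0 /= !mul1r mul0r addr0.
Qed.

(** The imaginary part of the same constant product, whose real part is [cst1]. *)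
Let cst0 t : expR (- (x * t)) * (cos (y * t) * G t - sin (y * t) * F t) = 0.
Proof.
set g := fun t => expR (- (x * t)) * (cos (y * t) * G t - sin (y * t) * F t).
rewrite -/(g t) (_ : g t = g 0); last first.
  apply: is_derive_0_is_cst => {}t.
  have DF := F_derive t; have DG := G_derive t; rewrite /g.
  by apply: trigger_derive; rewrite /GRing.scale /=; ring.
by rewrite /g !mulr0 oppr0 expR0 cos0 sin0 /G f0 /= !mul1r mul0r subr0.
Qed.

Lemma cvg_exp_series : series (fun m => (m`!%:R)^-1 * z ^+ m) @ \oo --> cexp z.
Proof.
have e0 : expR x * expR (- x) = 1 by rewrite -expRD subrr expR0.
have cs := cos2Dsin2 y; move: (cst1 1) (cst0 1); rewrite !mulr1 => c1 c0.
(* At time 1 the two constants form a linear system in [F 1] and [G 1], a rotation by [-y] scaled by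
   [expR (- x)]; the inverse rotation and scaling solve it. *)
have F1 : F 1 = expR x * cos y.
  have -> : F 1 = expR x * expR (- x) * ((cos y ^+ 2 + sin y ^+ 2) * F 1).
    by rewrite e0 cs !mul1r.
  transitivity (expR x * (cos y * (expR (- x) * (cos y * F 1 + sin y * G 1))
     - sin y * (expR (- x) * (cos y * G 1 - sin y * F 1)))); first by ring.
  by rewrite c1 c0; ring.
have G1 : G 1 = expR x * sin y.
  have -> : G 1 = expR x * expR (- x) * ((cos y ^+ 2 + sin y ^+ 2) * G 1).
    by rewrite e0 cs !mul1r.
  transitivity (expR x * (sin y * (expR (- x) * (cos y * F 1 + sin y * G 1))
     + cos y * (expR (- x) * (cos y * G 1 - sin y * F 1)))); first by ring.
  by rewrite c1 c0; ring.
have -> : cexp z = (F 1 +i* G 1).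
  by rewrite F1 G1 /cexp /cplx_of /expi -/x -/y; simpc.
have -> : series (fun m => (m`!%:R)^-1 * z ^+ m) =
   (fun m => pseries (c 1) 1 m +i* pseries (c (0 -i* 1)) 1 m).
  apply/funext => n; rewrite /pseries /series /=; elim: n => [|n IH].
    by rewrite !big_nil.
  rewrite !big_nat_recr //= {}IH.
  set u := \sum_(_ <= _ < _) _; set v := \sum_(_ <= _ < _) _.
  rewrite /c expr1n !mulr1 mul1r.
  have -> : (n`!%:R)^-1 = (n`!%:R^-1)%:C :> C by rewrite fmorphV rmorph_nat.
  by case: (z ^+ n) => a b; simpc; rewrite /= ![_^-1 * _]mulrC.
by apply: (@cvg_cplx _ _ _ (pseries (c 1) 1)); exact: is_cvg_c.
Qed.

End Series.

Lemma cexpD (z w : C) : cexp (z + w) = cexp z * cexp w.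
Proof.
case: z w => [a b] [c d]; rewrite /cexp /cplx_of /expi; simpc => /=.
by rewrite expRD cosD sinD; congr (_ +i* _); ring.
Qed.

Lemma cexp0 : cexp 0 = 1.
Proof. by rewrite /cexp /cplx_of /expi /= expR0 cos0 sin0; simpc. Qed.

Lemma norm_cexp (z : C) : `|cexp z| = cplx_of (expR (complex.Re z)).
Proof.
rewrite /cexp normrM cplx_of_norm (ger0_norm (expR_ge0 _)).
have -> : `|expi (complex.Im z)| = 1.
  by rewrite /expi normc_def /= cos2Dsin2 sqrtr1.
by rewrite mulr1.
Qed.

(** Bridge between two real parts: ['Re] takes values in [C], [complex.Re] in [R]. *)
Lemma Re_Cplx (z : C) : 'Re z = cplx_of (complex.Re z).
Proof. by rewrite /cplx_of complexRe. Qed.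

Lemma norm_cexp_unit (z : C) : 'Re z = 0 -> `|cexp z| = 1.
Proof.
move=> z0; rewrite norm_cexp; move: z0; rewrite Re_Cplx => /complexI ->.
by rewrite expR0.
Qed.

Lemma cexp_decay (z : C) : complex.Re z < 0 ->
  (fun t : R => `|cexp (cplx_of t * z)|) @ +oo --> (0 : C).
Proof.
move=> z0.
have -> : (fun t : R => `|cexp (cplx_of t * z)|) =
    (fun t => cplx_of (expR (t * complex.Re z))).
  apply/funext => t; rewrite norm_cexp; case: z {z0} => a b.
  by rewrite /cplx_of; simpc.
have Mz0 : 0 < - complex.Re z by rewrite oppr_gt0.
have H : (fun t : R => expR (t * complex.Re z)) @ +oo --> (0 : R).
  rewrite (_ : (fun t => _) = (fun u => expR (- u)) \o (fun t => t * - complex.Re z)).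
    by apply: cvg_comp (@cvgr_expR R); apply: gt0_cvgMly => //; exact: cvg_id.
  by apply/funext => t /=; rewrite mulrN opprK.
exact: (continuous_cvg _ (@cplx_of_continuous 0) H).
Qed.

End ComplexExponential.

(** * Operators diagonal in an orthonormal basis *)

Section OrthogonalProjection.
Context {K : numClosedFieldType} {n p : nat}.
Implicit Types (U : 'M[K]_(n, p)) (v : 'cV[K]_n).

Lemma orthoproj_id U v : (v^T <= U^T)%MS -> orthoproj U *m v = v.
Proof. by move=> vU; rewrite -[LHS]trmxK trmx_mul trmxK proj_ortho_id ?trmxK. Qed.

Lemma orthoproj_0 U v : U^t* *m v = 0 -> orthoproj U *m v = 0.
Proof.
move=> Uv; rewrite -[LHS]trmxK trmx_mul trmxK proj_ortho_0 ?trmx0 //.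
(* Orthogonality of the rows [v^T] and [U^T] is the transpose of the hypothesis. *)
by apply/orthomx1P; rewrite trmxK -[map_mx _ U]trmxK map_trmx -trmx_mul Uv trmx0.
Qed.

End OrthogonalProjection.

Section OrthonormalBasis.
Local Open Scope classical_set_scope.
Context {K : numClosedFieldType} {n : nat}.
Variable e : 'I_n -> 'cV[K]_n.
Hypothesis e_orthonormal : forall a b, (e a)^t* *m e b = ((a == b)%:R)%:M.

Definition mxcoef (a b : 'I_n) (X : 'M[K]_n) : K := ((e a)^t* *m X *m e b) 0 0.

Fact mxcoef_linear a b : linear_for *%R (mxcoef a b).
Proof.
by move=> c X Y; rewrite /mxcoef mulmxDr mulmxDl -scalemxAr -scalemxAl !mxE.
Qed.

HB.instance Definition _ a b :=
  GRing.isLinear.Build K 'M[K]_n K *%R (mxcoef a b) (mxcoef_linear a b).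

Lemma mxcoefB a b X Y : mxcoef a b (X - Y) = mxcoef a b X - mxcoef a b Y.
Proof. exact: raddfB. Qed.

Lemma mul_ketbra (u v w : 'cV[K]_n) :
  ketbra u v *m w = (v^t* *m w) 0 0 *: u.
Proof. by rewrite /ketbra -mulmxA [v^t* *m w]mx11_scalar mul_mx_scalar !mxE mulr1n. Qed.

Lemma mul_mx_ketbra (A : 'M[K]_n) (u v : 'cV[K]_n) :
  A *m ketbra u v = ketbra (A *m u) v.
Proof. by rewrite /ketbra mulmxA. Qed.

Lemma mul_ketbra_mx (A : 'M[K]_n) (u v : 'cV[K]_n) :
  ketbra u v *m A = ketbra u (A^t* *m v).
Proof. by rewrite /ketbra -mulmxA trmx_mul map_mxM trmxCK. Qed.

Lemma ketbraZl c (u v : 'cV[K]_n) : ketbra (c *: u) v = c *: ketbra u v.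
Proof. by rewrite /ketbra scalemxAl. Qed.

Lemma ketbraZr c (u v : 'cV[K]_n) : ketbra u (c *: v) = c^* *: ketbra u v.
Proof. by rewrite /ketbra linearZ /= map_mxZ scalemxAr. Qed.

Definition kb (p : 'I_n * 'I_n) : 'M[K]_n := ketbra (e p.1) (e p.2).

Lemma mul_kb a b c : kb (a, b) *m e c = (b == c)%:R *: e a.
Proof. by rewrite /kb mul_ketbra e_orthonormal !mxE mulr1n. Qed.

Lemma mxcoef_kb a b p : mxcoef a b (kb p) = (p == (a, b))%:R.
Proof.
case: p => c d; rewrite /mxcoef -mulmxA mul_kb -scalemxAr e_orthonormal !mxE mulr1n.
by rewrite -natrM mulnb xpair_eqE andbC ![_ == c]eq_sym.
Qed.

(** Completeness relation. The square matrix [E] with columns [e j] has its adjoint as a left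
    inverse, hence also as a right inverse. *)
Lemma sum_kb_diag : \sum_a kb (a, a) = 1%:M.
Proof.
pose E : 'M[K]_n := \matrix_(i, j) e j i 0.
have EE : E^t* *m E = 1%:M.
  apply/matrixP => i j; have := congr1 (fun M : 'M[K]_1 => M 0 0) (e_orthonormal i j).
  by rewrite !mxE mulr1n => <-; apply: eq_bigr => k _; rewrite !mxE.
rewrite -(mulmx1C EE); apply/matrixP => i j; rewrite summxE !mxE.
by apply: eq_bigr => k _; rewrite /kb /ketbra !mxE big_ord1 !mxE.
Qed.

(** The completeness relation is inserted on both sides of [X]. *)
Lemma mx_kbE X : X = \sum_p mxcoef p.1 p.2 X *: kb p.
Proof.
rewrite -[LHS]mul1mx -[LHS]mulmx1 -sum_kb_diag mulmx_suml mulmx_suml.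
rewrite -(pair_bigA _ (fun a b => mxcoef a b X *: kb (a, b))) /=.
apply: eq_bigr => a _; rewrite mulmx_sumr; apply: eq_bigr => b _.
have -> : kb (a, a) *m X *m kb (b, b) = e a *m ((e a)^t* *m X *m e b) *m ((e b)^t* ).
  by rewrite /kb /ketbra !mulmxA.
by rewrite [X in e a *m X]mx11_scalar mul_mx_scalar -scalemxAl.
Qed.

Lemma mx_kbP X Y : (forall a b, mxcoef a b X = mxcoef a b Y) -> X = Y.
Proof.
by move=> XY; rewrite [X]mx_kbE [Y]mx_kbE; apply: eq_bigr => p _; rewrite XY.
Qed.

Lemma mxcoef_sum_kb a b (c : 'I_n * 'I_n -> K) :
  mxcoef a b (\sum_p c p *: kb p) = c (a, b).
Proof.
rewrite raddf_sum (bigD1 (a, b)) //= big1 => [|p pab].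
  by rewrite linearZ /= mxcoef_kb eqxx mulr1 addr0.
by rewrite linearZ /= mxcoef_kb (negPf pab) mulr0.
Qed.

Lemma span_kb (s : seq ('I_n * 'I_n)) X :
  (forall a b, (a, b) \notin s -> mxcoef a b X = 0) -> X \in <<map kb s>>%VS.
Proof.
move=> Xs; rewrite [X]mx_kbE memv_suml // => -[a b] _ /=.
have [abs|/Xs ->] := boolP ((a, b) \in s); last by rewrite scale0r mem0v.
by rewrite memvZ // memv_span // map_f.
Qed.

Lemma mxcoef_span_kb (s : seq ('I_n * 'I_n)) X a b :
  X \in <<map kb s>>%VS -> (a, b) \notin s -> mxcoef a b X = 0.
Proof.
move=> Xs abs; rewrite (coord_span (X := in_tuple (map kb s)) Xs).
rewrite raddf_sum big1 // => i _.
have is_ : (i < size s)%N by apply: leq_trans (ltn_ord i) _; rewrite size_map.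
rewrite /= linearZ /= (nth_map (a, b)) // mxcoef_kb.
rewrite (_ : _ == _ = false) ?mulr0 //; apply: contraNF abs => /eqP <-.
exact: mem_nth.
Qed.

(** The coefficient at [(a, b)] is 1 on [kb (a, b)] and vanishes on the span of the remaining
    operators. *)
Lemma free_kb (s : seq ('I_n * 'I_n)) : uniq s -> free (map kb s).
Proof.
elim: s => [|[a b] s IH] /=; first by rewrite nil_free.
case/andP=> abs /IH fs; rewrite free_cons fs andbT; apply/negP => kbs.
have := mxcoef_kb a b (a, b); rewrite eqxx (mxcoef_span_kb kbs abs) => /eqP.
by rewrite eq_sym oner_eq0.
Qed.

Lemma adj_ketbra (u v : 'cV[K]_n) : (ketbra u v)^t* = ketbra v u.
Proof. by rewrite /ketbra trmx_mul map_mxM trmxCK. Qed.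

Section DiagonalOperator.
Variables (D : 'M[K]_n) (d : 'I_n -> K).
Hypothesis D_e : forall a, D *m e a = d a *: e a.

Lemma diag_mul_kb a b : D *m kb (a, b) = d a *: kb (a, b).
Proof. by rewrite mul_mx_ketbra D_e ketbraZl. Qed.

(** The hypothesis only describes [D] acting from the left; completeness, inserted after [D],
    transfers it to right multiplication. *)
Lemma kb_mul_diag a b : kb (a, b) *m D = d b *: kb (a, b).
Proof.
rewrite -[X in _ *m X]mulmx1 -sum_kb_diag !mulmx_sumr (bigD1 b) //= big1 => [|c cb].
  rewrite diag_mul_kb -scalemxAr mul_mx_ketbra mul_kb eqxx scale1r addr0.
  by [].
rewrite diag_mul_kb -scalemxAr mul_mx_ketbra mul_kb eq_sym (negPf cb) scale0r.
by rewrite /ketbra mul0mx scaler0.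
Qed.

Lemma kb_mul_adj a b : kb (a, b) *m D^t* = (d b)^* *: kb (a, b).
Proof. by rewrite mul_ketbra_mx trmxCK D_e ketbraZr. Qed.

(** Adjoint of [kb_mul_diag] with the indices exchanged: an operator diagonal in an orthonormal
    basis is normal. *)
Lemma adj_mul_kb a b : D^t* *m kb (a, b) = (d a)^* *: kb (a, b).
Proof.
have := congr1 (fun M => M^t*) (kb_mul_diag b a).
by rewrite trmx_mul map_mxM linearZ /= map_mxZ adj_ketbra.
Qed.

End DiagonalOperator.

Lemma mxcoef_mul_diag (A B : 'M[K]_n) (al be : 'I_n -> K) X a b :
    (forall c, A *m e c = al c *: e c) -> (forall c, B *m e c = be c *: e c) ->
  mxcoef a b (A *m X *m B) = al a * be b * mxcoef a b X.
Proof.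
move=> Ae Be; rewrite -(mxcoef_sum_kb a b
  (fun p => al p.1 * be p.2 * mxcoef p.1 p.2 X)).
congr (mxcoef a b _); rewrite {1}[X]mx_kbE mulmx_sumr mulmx_suml.
apply: eq_bigr => -[c d] _; rewrite -scalemxAr -scalemxAl (diag_mul_kb Ae) -scalemxAl.
by rewrite (kb_mul_diag Be) !scalerA; congr (_ *: _) => /=; ring.
Qed.

(** * Generators whose Hamiltonian and Lindblad operator share an orthonormal eigenbasis *)

Section NormalLindbladian.
Variables (H L : 'M[K]_n) (h l : 'I_n -> K).
Hypothesis H_e : forall a, H *m e a = h a *: e a.
Hypothesis L_e : forall a, L *m e a = l a *: e a.
Hypothesis h_real : forall a, h a \is Num.real.

Definition lindblad_rate (a b : 'I_n) : K :=
  - 'i * (h a - h b) + l a * (l b)^* - 2^-1 * (l a * (l a)^* + l b * (l b)^* ).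

Lemma lindblad_kb a b : lindblad H L (kb (a, b)) = lindblad_rate a b *: kb (a, b).
Proof.
rewrite lfunE /= /lindblad_fun mulmxA -![_ *m _ *m kb _]mulmxA.
rewrite (diag_mul_kb H_e) (kb_mul_diag H_e) (diag_mul_kb L_e) (kb_mul_adj L_e).
rewrite -!scalemxAl -!scalemxAr (kb_mul_adj L_e) (adj_mul_kb L_e) (kb_mul_diag L_e).
rewrite /lindblad_rate; move: (kb _) => X; apply/matrixP => i j; rewrite !mxE; ring.
Qed.

(** The commutator term is purely imaginary because the energies are real; the real part of the rest
    completes the square. *)
Lemma Re_lindblad_rate a b : 'Re (lindblad_rate a b) = - (`|l a - l b| ^+ 2 / 2).
Proof.
rewrite /lindblad_rate ReE normCK !(rmorphB, rmorphD, rmorphM, rmorphN) /= !conjCK.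
rewrite conjCi !(CrealP (h_real _)) fmorphV rmorph_nat.
by field.
Qed.

(** For equal eigenvalues of [L] the jump term and the anticommutator cancel, leaving the unitary
    phase. *)
Lemma lindblad_rate_eq a b : l a = l b -> lindblad_rate a b = - 'i * (h a - h b).
Proof. by move=> lab; rewrite /lindblad_rate lab; field. Qed.

End NormalLindbladian.

(** * Attractor space of a superoperator diagonal on the operators [kb] *)

Section DiagonalSuperoperator.
Variables (F : 'End('M[K]_n)) (mu : 'I_n -> 'I_n -> K).
Hypothesis F_kb : forall a b, F (kb (a, b)) = mu a b *: kb (a, b).

Lemma diag_supE X : F X = \sum_p (mu p.1 p.2 * mxcoef p.1 p.2 X) *: kb p.
Proof.
rewrite {1}[X]mx_kbE linear_sum; apply: eq_bigr => -[a b] _.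
by rewrite linearZ /= F_kb scalerA mulrC.
Qed.

Lemma mxcoef_diag_sup a b X : mxcoef a b (F X) = mu a b * mxcoef a b X.
Proof. by rewrite diag_supE (mxcoef_sum_kb _ _ (fun p => mu p.1 p.2 * _)). Qed.

Lemma mem_leigenspace l X :
  (X \in passmx.leigenspace F l) = (F X == l *: X).
Proof. by rewrite memv_ker add_lfunE opp_lfunE scale_lfunE id_lfunE subr_eq0. Qed.

Lemma attractor_diag (s : seq ('I_n * 'I_n)) :
    (forall a b, ((a, b) \in s) = ('Re (mu a b) == 0)) ->
  attractor F = <<map kb s>>%VS.
Proof.
(* [S] lists the imaginary eigenvalues once each, so that the sum over a finite set becomes a sum
   over a duplicate-free sequence. *)
move=> sP; pose S := undup [seq mu p.1 p.2 | p <- s].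
have -> : attractor F = \big[addv/0%VS]_(l <- S) passmx.leigenspace F l.
  rewrite /attractor (_ : [set l | _] = [set` S]).
    by rewrite -fsbig_seq ?undup_uniq.
  apply/seteqP; split=> l /=.
    case=> lF l0; have /negP X0 := lF.
    have [X XF Xn0] : exists2 X, X \in passmx.leigenspace F l & X != 0.
      by exists (vpick (passmx.leigenspace F l)); rewrite ?memv_pick ?vpick0.
    (* A nonzero eigenvector has a nonzero coefficient somewhere, and that coefficient forces
       [l = mu a b]. *)
    have [a [b Xab]] : exists a b, mxcoef a b X != 0.
      apply/not_existsP => H; case/eqP: Xn0; apply: mx_kbP => a b.
      rewrite raddf0; apply/eqP/negPn/negP => ?; apply: (H a); by exists b.
    move: XF; rewrite mem_leigenspace => /eqP /(congr1 (mxcoef a b)).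
    rewrite mxcoef_diag_sup linearZ /= => /(mulIf Xab) muab.
    rewrite mem_undup; apply/mapP; exists (a, b) => //.
    by rewrite sP muab l0.
  rewrite mem_undup => /mapP [[a b]]; rewrite sP => /eqP mu0 ->; split=> //.
  apply/negP => /eqP l0; have : kb (a, b) \in passmx.leigenspace F (mu a b).
    by rewrite mem_leigenspace F_kb.
  rewrite l0 memv0 => /eqP /(congr1 (mxcoef a b)) /eqP.
  by rewrite mxcoef_kb eqxx raddf0 oner_eq0.
apply/eqP; rewrite eqEsubv; apply/andP; split.
  (* Sum of eigenspaces inside the span: a vector of the eigenspace of [l] has no coefficient where
     [mu a b] differs from [l]. *)
  rewrite big_seq; elim/big_rec: _ => [|l U lS US]; first exact: sub0v.
  rewrite subv_add US andbT; apply/subvP => X; rewrite mem_leigenspace => /eqP XF.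
  apply: span_kb => a b; rewrite sP => mu0; apply/eqP.
  have l0 : 'Re l = 0.
    move: lS; rewrite mem_undup => /mapP [[c d]] /=.
    by rewrite sP => /eqP + ->.
  apply: contraNT mu0 => Xab; move/(congr1 (mxcoef a b)): XF.
  by rewrite mxcoef_diag_sup linearZ /= => /(mulIf Xab) ->; rewrite l0.
apply/span_subvP => _ /mapP [[a b] abs ->].
have muS : mu a b \in S.
  by rewrite mem_undup; apply/mapP; exists (a, b).
rewrite (bigD1_seq _ muS) ?undup_uniq //=; apply: (subvP (addvSl _ _)).
by rewrite mem_leigenspace F_kb.
Qed.

End DiagonalSuperoperator.
End OrthonormalBasis.

(** * Long-time dynamics *)

Section DiagonalDynamics.
Local Open Scope classical_set_scope.
Context {R : realType} {n : nat}.
Local Notation C := (Cplx R).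

Lemma cvg_lincomb (K : numFieldType) (V : normedModType K) (T I : Type)
    (F : set_system T) (FF : Filter F) (r : seq I) (c : I -> T -> K) (l : I -> K)
    (v : I -> V) :
  (forall i, c i @ F --> l i) ->
  (fun t => \sum_(i <- r) c i t *: v i) @ F --> \sum_(i <- r) l i *: v i.
Proof.
move=> cl; elim: r => [|i r IH].
  rewrite big_nil (_ : (fun t => _) = cst 0); first exact: cvg_cst.
  by apply/funext => t; rewrite big_nil.
rewrite big_cons (_ : (fun t => _) =
  (fun t => c i t *: v i + \sum_(i <- r) c i t *: v i)); last first.
  by apply/funext => t; rewrite big_cons.
by apply: cvgD => //; apply: cvgZr_tmp.
Qed.

Variable e : 'I_n.+1 -> 'cV[C]_n.+1.
Hypothesis e_orthonormal : forall a b, (e a)^t* *m e b = ((a == b)%:R)%:M.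
Local Notation kb := (kb e).
Local Notation mxcoef := (mxcoef e).

(** Iterating [F] raises each [mu a b] to a power, so every partial sum is a finite combination of
    the [kb] with partial scalar exponential series as coefficients. *)
Lemma mxcoef_expsup (F : 'End('M[C]_n.+1)) (mu : 'I_n.+1 -> 'I_n.+1 -> C) a b X :
    (forall a b, F (kb (a, b)) = mu a b *: kb (a, b)) ->
  mxcoef a b (expsup F X) = cexp (mu a b) * mxcoef a b X.
Proof.
move=> F_kb.
pose c (p : 'I_n.+1 * 'I_n.+1) := mxcoef p.1 p.2 X.
suff -> : expsup F X = \sum_p (cexp (mu p.1 p.2) * c p) *: kb p.
  by rewrite (mxcoef_sum_kb e_orthonormal _ _ (fun p => cexp (mu p.1 p.2) * c p)).
apply: cvg_lim; first exact: norm_hausdorff.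
rewrite (_ : series _ = (fun N => \sum_p
   (series (fun m => (m`!%:R)^-1 * mu p.1 p.2 ^+ m) N * c p) *: kb p)); last first.
  apply/funext => N; rewrite /series /=.
  under [RHS]eq_bigr do rewrite mulr_suml scaler_suml.
  rewrite exchange_big /=; apply: eq_bigr => m _.
  have -> : iter m F X = \sum_p (mu p.1 p.2 ^+ m * c p) *: kb p.
    elim: m => [|m IH] /=.
      by under eq_bigr do rewrite expr0 mul1r; exact: (mx_kbE e_orthonormal).
    rewrite IH linear_sum; apply: eq_bigr => -[a' b'] _.
    by rewrite linearZ /= F_kb scalerA exprS; congr (_ *: _); ring.
  by rewrite scaler_sumr; apply: eq_bigr => p _; rewrite scalerA mulrA.
by apply: cvg_lincomb => p; apply: cvgMl; exact: cvg_exp_series.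
Qed.

Lemma expmx_diag (A : 'M[C]_n.+1) (h : 'I_n.+1 -> C) :
    (forall a, A *m e a = h a *: e a) ->
  expmx A = \sum_a cexp (h a) *: kb (a, a).
Proof.
move=> Ae; apply: cvg_lim; first exact: norm_hausdorff.
rewrite (_ : series _ = (fun N => \sum_a
   series (fun m => (m`!%:R)^-1 * h a ^+ m) N *: kb (a, a))); last first.
  apply/funext => N; rewrite /series /=.
  under [RHS]eq_bigr do rewrite scaler_suml.
  rewrite exchange_big /=; apply: eq_bigr => m _.
  (* [A ^+ m] is applied to the completeness relation term by term. *)
  have -> : A ^+ m = \sum_a (h a ^+ m) *: kb (a, a).
    rewrite -[LHS]mulr1 -[X in _ * X](sum_kb_diag e_orthonormal) mulr_sumr.
    apply: eq_bigr => a _; elim: m => [|m IH]; first by rewrite !expr0 mul1r scale1r.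
    rewrite exprS -mulrA IH -scalerAr -[A * _]/(A *m _) mul_mx_ketbra Ae ketbraZl.
    by rewrite scalerA exprSr.
  by rewrite scaler_sumr; apply: eq_bigr => a _; rewrite scalerA.
by apply: cvg_lincomb => a; exact: cvg_exp_series.
Qed.

(** A coefficient is a fixed linear combination of the matrix entries, which are continuous. *)
Lemma cvg_mxcoef a b (T : Type) (F : set_system T) (FF : Filter F)
    (X : T -> 'M[C]_n.+1) Y :
  X @ F --> Y -> (fun t => mxcoef a b (X t)) @ F --> mxcoef a b Y.
Proof.
move=> XY.
have E Z : mxcoef a b Z = \sum_(p : 'I_n.+1 * 'I_n.+1)
    Z p.1 p.2 *: ((e a)^t* 0 p.1 * e b p.2 0 : C^o).
  rewrite /mxcoef -mulmxA mxE.
  rewrite -(pair_bigA _ (fun i j => Z i j *: ((e a)^t* 0 i * e b j 0 : C^o))) /=.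
  apply: eq_bigr => i _; rewrite [(Z *m _) _ _]mxE mulr_sumr.
  by apply: eq_bigr => j _; rewrite /GRing.scale /= mulrCA.
rewrite E (_ : (fun t => _) = (fun t => \sum_(p : 'I_n.+1 * 'I_n.+1)
    X t p.1 p.2 *: ((e a)^t* 0 p.1 * e b p.2 0 : C^o))).
  apply: cvg_lincomb => p.
  exact: (continuous_cvg _ (@coord_continuous _ _ _ p.1 p.2 Y) XY).
by apply/funext => t; rewrite E.
Qed.

Variables (F : 'End('M[C]_n.+1)) (mu : 'I_n.+1 -> 'I_n.+1 -> C).
Hypothesis F_kb : forall a b, F (kb (a, b)) = mu a b *: kb (a, b).
Hypothesis mu_le0 : forall a b, 'Re (mu a b) <= 0.

Lemma mxcoef_semigroup t a b X :
  mxcoef a b (semigroup F t X) = cexp (cplx_of t * mu a b) * mxcoef a b X.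
Proof.
rewrite /semigroup (@mxcoef_expsup _ (fun a b => cplx_of t * mu a b)) // => c d.
by rewrite scale_lfunE F_kb scalerA.
Qed.

Lemma mem_attractor X :
  X \in attractor F <-> forall a b, 'Re (mu a b) != 0 -> mxcoef a b X = 0.
Proof.
pose s := [seq p <- enum {: 'I_n.+1 * 'I_n.+1} | 'Re (mu p.1 p.2) == 0].
have sP a b : ((a, b) \in s) = ('Re (mu a b) == 0).
  by rewrite mem_filter mem_enum andbT.
rewrite (attractor_diag e_orthonormal F_kb sP); split=> [Xs a b mu0|X0].
  by apply: (mxcoef_span_kb e_orthonormal Xs); rewrite sP.
by apply: span_kb => // a b; rewrite sP; exact: X0.
Qed.

(** Gives uniqueness and existence at once: left to right determines the trajectory for nonnegative
    times, right to left checks that it is one. *)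
Lemma asymptotic_dynamicsP rho0 (rho_as : R -> 'M[C]_n.+1) :
  asymptotic_dynamics F rho0 rho_as <->
  forall t, 0 <= t -> forall a b, mxcoef a b (rho_as t) =
    if 'Re (mu a b) == 0 then cexp (cplx_of t * mu a b) * mxcoef a b rho0 else 0.
Proof.
have Remu t a b : 'Re (mu a b) = 0 -> 'Re (cplx_of t * mu a b) = 0.
  rewrite !Re_Cplx /cplx_of => /complexI; case: (mu a b) => x y /= ->.
  by rewrite !(mul0r, mulr0, oppr0, subr0).
split=> [[mem traj lim] t t0 a b|H].
  have [mu0|mu0] := eqVneq ('Re (mu a b)) 0; last first.
    by move/mem_attractor: (mem t t0); apply.
  (* From here the semigroup is abstracted to its coefficient formula; it remains to compare the
     coefficients of [rho_as 0] and [rho0]. *)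
  rewrite (traj t t0); move: (mxcoef_semigroup t a b).
  move: (semigroup F t) => S SE; rewrite SE; congr (_ * _); apply/eqP; clear S SE.
  rewrite eq_sym -subr_eq0 -normr_le0.
  have {}lim : (fun t => `|mxcoef a b (semigroup F t rho0 - rho_as t)|) @ +oo
      --> (0 : C).
    apply/norm_cvg0P; rewrite -(raddf0 (mxcoef a b)).
    by apply: cvg_mxcoef; apply/norm_cvg0P.
  (* Both coefficients carry the same phase of modulus 1, so their distance does not depend on time
     and must equal its limit 0. *)
  have cst : \forall t \near +oo,
     `|mxcoef a b (semigroup F t rho0 - rho_as t)| =
     `|mxcoef a b rho0 - mxcoef a b (rho_as 0)|.
    near=> s; have s0 : 0 <= s by near: s; exact: nbhs_pinfty_ge.
    rewrite (traj s s0) mxcoefB; move: (mxcoef_semigroup s a b).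
    move: (semigroup F s) => S SE; rewrite !SE -mulrBr normrM.
    by rewrite norm_cexp_unit ?mul1r //; exact: Remu.
  rewrite (_ : `|_| = 0) //.
  exact: (cvg_unique (@norm_hausdorff _ _) (cvg_near_cst _ cst) lim).
(* At time 0 the formula says that [rho_as 0] keeps exactly the non-decaying coefficients of
   [rho0]. *)
have H0 := H 0 (lexx 0).
have cexp0t x : cexp (cplx_of (0 : R) * x) = 1.
  by rewrite /cplx_of mul0r cexp0.
split=> [t t0|t t0|].
- by apply/mem_attractor => a b /negPf mu0; rewrite H // mu0.
- apply: (mx_kbP e_orthonormal) => a b; move: (mxcoef_semigroup t a b).
  move: (semigroup F t) => S SE; rewrite SE H // H0.
  by case: ifP => _; rewrite ?mulr0 // cexp0t mul1r.
apply/norm_cvg0P.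
(* [D] collects the decaying modes. It agrees with the difference for nonnegative times, which
   suffices near infinity. *)
pose D t := \sum_(p : 'I_n.+1 * 'I_n.+1) (if 'Re (mu p.1 p.2) == 0 then 0
   else cexp (cplx_of t * mu p.1 p.2) * mxcoef p.1 p.2 rho0) *: kb p.
have D0 : D @ +oo --> (0 : 'M[C]_n.+1).
  rewrite [X in _ --> X](_ : _ = \sum_(p : 'I_n.+1 * 'I_n.+1) 0 *: kb p).
    apply: cvg_lincomb => p; case: eqP => [_|/eqP mu0]; first exact: cvg_cst.
    rewrite -[0](mul0r (mxcoef p.1 p.2 rho0)); apply: cvgMl.
    apply/norm_cvg0P; apply: cexp_decay.
    move: mu0 (mu_le0 p.1 p.2); rewrite Re_Cplx -[0]/(cplx_of 0) lecR => mu0.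
    by rewrite le_eqVlt => /predU1P [mu0'|//]; rewrite mu0' eqxx in mu0.
  by rewrite big1 // => p _; rewrite scale0r.
apply: cvg_trans D0; apply: near_eq_cvg; near=> t.
have t0 : 0 <= t by near: t; exact: nbhs_pinfty_ge.
apply: (mx_kbP e_orthonormal) => a b.
rewrite mxcoefB; move: (mxcoef_semigroup t a b).
move: (semigroup F t) => S SE; rewrite SE H // /D mxcoef_sum_kb //=.
by case: ifP; rewrite ?subrr ?subr0.
Unshelve. all: by end_near. Qed.

End DiagonalDynamics.

(** * The two-qubit swap *)

Section TwoQubitSwap.
Context {R : realType}.
Local Notation C := (Cplx R).

Lemma ord4P (x : 'I_4) : exists ij : 'I_2 * 'I_2, x = @mxtens_index 2 2 ij.
Proof. by exists (@mxtens_unindex 2 2 x); rewrite mxtens_unindexK. Qed.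

Lemma ketE (i j : 'I_2) : ket i j = delta_mx (mxtens_index (i, j)) 0 :> 'cV[C]_4.
Proof.
apply/matrixP => x y; rewrite /ket [y]ord1.
have [[a b] ->] := ord4P x.
(* The column index is rewritten as a pair in ['I_1 * 'I_1], the form expected by [tensmxE]. *)
transitivity (((delta_mx i 0 : 'cV[C]_2) *t (delta_mx j 0 : 'cV[C]_2))
    (mxtens_index (a, b)) (mxtens_index (0 : 'I_1, 0 : 'I_1))).
  by congr (_ _ _); apply: val_inj.
rewrite tensmxE !mxE (can_eq (@mxtens_indexK 2 2)) xpair_eqE !eqxx !andbT.
by rewrite -natrM mulnb.
Qed.

Lemma ket_inner (i j k l : 'I_2) :
  (ket i j)^t* *m ket k l = ((i == k) && (j == l))%:R%:M :> 'M[C]_1.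
Proof.
rewrite !ketE trmx_delta map_delta_mx mul_delta_mx_cond.
rewrite (can_eq (@mxtens_indexK 2 2)) xpair_eqE.
by apply/matrixP => x y; rewrite [x]ord1 [y]ord1; case: (_ && _); rewrite !mxE.
Qed.

Lemma hamiltonian_ket (E0 E1 : R) (i j : 'I_2) :
  hamiltonian E0 E1 *m ket i j =
    cplx_of ((if i == 0 then E0 else E1) + (if j == 0 then E0 else E1)) *: ket i j.
Proof.
rewrite ketE -colE; apply/matrixP => x y; rewrite [y]ord1.
have [[a b] ->] := ord4P x; rewrite !mxE !mxtens_indexK /=.
rewrite (can_eq (@mxtens_indexK 2 2)) xpair_eqE andbT.
rewrite [cplx_of (_ + _)]rmorphD /=.
by case: (eqVneq a i) => [->|_]; case: (eqVneq b j) => [->|_];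
  rewrite /= ?mulr1n ?mulr0n ?mulr1 ?mul1r ?mulr0 ?mul0r ?addr0.
Qed.

Definition inner (u v : 'cV[C]_4) : C := (u^t* *m v) 0 0.

Lemma innerE u v : u^t* *m v = (inner u v)%:M.
Proof. exact: mx11_scalar. Qed.

Lemma innerDl u v w : inner (u + v) w = inner u w + inner v w.
Proof. by rewrite /inner linearD /= map_mxD mulmxDl mxE. Qed.

Lemma innerDr u v w : inner u (v + w) = inner u v + inner u w.
Proof. by rewrite /inner mulmxDr mxE. Qed.

Lemma innerZl c u v : inner (c *: u) v = c^* * inner u v.
Proof. by rewrite /inner linearZ /= map_mxZ -scalemxAl mxE. Qed.

Lemma innerZr c u v : inner u (c *: v) = c * inner u v.
Proof. by rewrite /inner -scalemxAr mxE. Qed.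

Lemma inner_ket (i j k l : 'I_2) :
  inner (ket i j) (ket k l) = ((i == k) && (j == l))%:R.
Proof. by rewrite /inner ket_inner !mxE mulr1n. Qed.

Lemma expi_conj (x : R) : (expi x)^* = expi (- x).
Proof. by rewrite /expi cosN sinN. Qed.

Lemma expiN_mul (x : R) : expi (- x) * expi x = 1.
Proof.
by rewrite -expi_conj -normCKC /expi normc_def /= cos2Dsin2 sqrtr1 expr1n.
Qed.

Variable phi : R.
Local Notation w := (expi phi).

Let r : C := (sqrtC 2)^-1.

Let r_conj : r^* = r.
Proof. by rewrite conj_Creal // /r rpredV ger0_real // sqrtC_ge0 ler0n. Qed.

Let rr : r * r = 2^-1.
Proof. by rewrite /r -invfM -expr2 sqrtCK. Qed.

Definition swap_basis (a : 'I_4) : 'cV[C]_4 :=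
  nth 0 [:: ket 0 0; psi1 phi; psi2 phi; ket 1 1] a.

(** One family for both vectors: [s = 1] gives [psi1], [s = -1] gives [psi2], and [s] is also the
    eigenvalue under the swap. *)
Let psi (s : C) : 'cV[C]_4 := r *: (ket 0 1 + (s * w) *: ket 1 0).

Let psi1E : psi1 phi = psi 1.
Proof. by rewrite /psi mul1r. Qed.

Let psi2E : psi2 phi = psi (-1).
Proof. by rewrite /psi mulN1r scaleNr. Qed.

Let inner_psi (s s' : C) : inner (psi s) (psi s') = (1 + s^* * s') / 2.
Proof.
rewrite /psi innerZl innerZr !innerDl !innerDr !innerZl !innerZr !inner_ket /=.
rewrite r_conj mulrA rr rmorphM /= expi_conj.
have -> : s^* * expi (- phi) * (s' * w * 1) = s^* * s' * (expi (- phi) * w) by ring.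
by rewrite expiN_mul; ring.
Qed.

Let inner_ket_psi (i : 'I_2) s : inner (ket i i) (psi s) = 0.
Proof.
rewrite /psi innerZr innerDr innerZr !inner_ket.
by case: i => [[|[|//]] ?]; rewrite /= !(mulr0, addr0).
Qed.

Let inner_psi_ket (i : 'I_2) s : inner (psi s) (ket i i) = 0.
Proof.
rewrite /psi innerZl innerDl innerZl !inner_ket.
by case: i => [[|[|//]] ?]; rewrite /= !(mulr0, addr0).
Qed.

Lemma swap_basis_orthonormal a b :
  (swap_basis a)^t* *m swap_basis b = ((a == b)%:R)%:M.
Proof.
have two : (1 + 1) / 2 = 1 :> C by rewrite -[1 + 1]/(2%:R) divff ?pnatr_eq0.
have p11 : inner (psi 1) (psi 1) = 1 by rewrite inner_psi rmorph1 mul1r.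
have p12 : inner (psi 1) (psi (-1)) = 0.
  by rewrite inner_psi rmorph1 mul1r subrr mul0r.
have p21 : inner (psi (-1)) (psi 1) = 0.
  by rewrite inner_psi rmorphN rmorph1 mulr1 subrr mul0r.
have p22 : inner (psi (-1)) (psi (-1)) = 1.
  by rewrite inner_psi rmorphN rmorph1 mulrNN mulr1.
have k0p s := inner_ket_psi 0 s; have k1p s := inner_ket_psi 1 s.
have pk0 s := inner_psi_ket 0 s; have pk1 s := inner_psi_ket 1 s.
have k00 := inner_ket 0 0 0 0; have k01 := inner_ket 0 0 1 1.
have k10 := inner_ket 1 1 0 0; have k11 := inner_ket 1 1 1 1.
rewrite innerE /swap_basis psi1E psi2E; congr (_%:M).
move: p11 p12 p21 p22 (k0p 1) (k0p (-1)) (k1p 1) (k1p (-1)) (pk0 1) (pk0 (-1))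
  (pk1 1) (pk1 (-1)) k00 k01 k10 k11.
(* Without this generalisation, failed comparisons of kets unfold tensor
   products. *)
move: (psi 1) (psi (-1)) (ket 0 0) (ket 1 1) => p q x y *.
by case: a b => [[|[|[|[|//]]]] ?] [[|[|[|[|//]]]] ?].
Qed.

Let mul_swap (x : 'cV[C]_4) : swap phi *m x =
  inner (ket 0 0) x *: ket 0 0 + (expi (- phi) * inner (ket 1 0) x) *: ket 0 1
  + (w * inner (ket 0 1) x) *: ket 1 0 + inner (ket 1 1) x *: ket 1 1.
Proof.
rewrite /swap; move: (ket 0 0) (ket 0 1) (ket 1 0) (ket 1 1) => k00 k01 k10 k11.
rewrite !mulmxDl -(scalemxAl (expi (- phi)) (ketbra k01 k10)).
rewrite -(scalemxAl w (ketbra k10 k01)).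
rewrite (mul_ketbra k00 k00) (mul_ketbra k01 k10) (mul_ketbra k10 k01).
by rewrite (mul_ketbra k11 k11) -!scalerA.
Qed.

Lemma swap_ket (i j : 'I_2) : swap phi *m ket i j =
  if i == j then ket i j else if i == 0 then w *: ket 1 0 else expi (- phi) *: ket 0 1.
Proof.
rewrite mul_swap !inner_ket.
case: i j => [[|[|//]] ?] [[|[|//]] ?];
  rewrite /= !(mulr0, mulr1, scale0r, scale1r) ?addr0 ?add0r //.
all: by congr ket; apply: val_inj.
Qed.

(** The phases cancel and leave a multiple of [s |01> + w |10>], which is [s] times the original
    because [s] squares to 1. *)
Let swap_psi s : s * s = 1 -> swap phi *m psi s = s *: psi s.
Proof.
move=> ss; move: (swap_ket 0 1) (swap_ket 1 0) (expiN_mul phi); rewrite /psi /=.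
move: (ket 0 1) (ket 1 0) (swap phi) w (expi (- phi)) r => x y S c c' q Sx Sy cc.
rewrite -scalemxAr mulmxDr -scalemxAr Sx Sy; apply/matrixP => i j; rewrite !mxE.
transitivity (q * (s * s * c * y i j + s * (c' * c) * x i j)); last by rewrite cc; ring.
by rewrite ss; ring.
Qed.

Definition swap_sign (a : 'I_4) : C := if a == 2 :> nat then -1 else 1.

Lemma swap_swap_basis a : swap phi *m swap_basis a = swap_sign a *: swap_basis a.
Proof.
have S0 : swap phi *m ket 0 0 = 1 *: ket 0 0 by rewrite swap_ket scale1r.
have S1 : swap phi *m ket 1 1 = 1 *: ket 1 1 by rewrite swap_ket scale1r.
have P1 : swap phi *m psi 1 = 1 *: psi 1 by apply: swap_psi; rewrite mulr1.
have P2 : swap phi *m psi (-1) = -1 *: psi (-1).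
  by apply: swap_psi; rewrite mulrNN mulr1.
rewrite /swap_basis psi1E psi2E; move: S0 S1 P1 P2.
move: (psi 1) (psi (-1)) (ket 0 0) (ket 1 1) (swap phi) => p q x y S S0 S1 P1 P2.
by case: a => [[|[|[|[|//]]]] ?].
Qed.

Definition level (E0 E1 : R) (a : 'I_4) : R :=
  nth 0 [:: E0 + E0; E0 + E1; E0 + E1; E1 + E1] a.

(** The kets [|01>] and [|10>] have the same energy, so every superposition of them is an
    eigenvector. *)
Let hamiltonian_psi (E0 E1 : R) s :
  hamiltonian E0 E1 *m psi s = cplx_of (E0 + E1) *: psi s.
Proof.
move: (hamiltonian_ket E0 E1 0 1) (hamiltonian_ket E0 E1 1 0).
rewrite /psi /= [E1 + E0]addrC.
move: (ket 0 1) (ket 1 0) (hamiltonian _ _) w (cplx_of _) r => x y H c h q Hx Hy.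
rewrite -scalemxAr mulmxDr -scalemxAr Hx Hy; apply/matrixP => i j; rewrite !mxE.
ring.
Qed.

Lemma hamiltonian_swap_basis (E0 E1 : R) a :
  hamiltonian E0 E1 *m swap_basis a = cplx_of (level E0 E1 a) *: swap_basis a.
Proof.
move: (hamiltonian_ket E0 E1 0 0) (hamiltonian_ket E0 E1 1 1).
move: (hamiltonian_psi E0 E1 1) (hamiltonian_psi E0 E1 (-1)).
rewrite /swap_basis psi1E psi2E /level /=.
move: (psi 1) (psi (-1)) (ket 0 0) (ket 1 1) (hamiltonian _ _) => p q x y H *.
by case: a => [[|[|[|[|//]]]] ?].
Qed.

(** Three basis vectors are columns of [U] and are fixed; [psi2] is orthogonal to all of them and is
    killed. *)
Lemma orthoproj_swap_basis a :
  orthoproj (row_mx (ket 0 0) (row_mx (psi1 phi) (ket 1 1))) *m swap_basis a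
  = (a != 2 :> nat)%:R *: swap_basis a.
Proof.
have := swap_basis_orthonormal.
rewrite /swap_basis; move: (psi1 phi) (psi2 phi) (ket 0 0) (ket 1 1) => p q x y on.
set U := row_mx _ _.
have UE : U^T = col_mx x^T (col_mx p^T y^T) by rewrite /U !tr_row_mx.
(* Splitting the trivial inclusion of [U^T] in itself along its rows gives the three memberships. *)
have := submx_refl U^T; rewrite {1}UE !col_mx_sub => /and3P [xU pU yU].
have Uq : U^t* *m q = 0.
  rewrite /U !tr_row_mx !map_col_mx !mul_col_mx.
  have q0 (i : 'I_4) (i2 : i == 2 :> nat = false) :
      (nth 0 [:: x; p; q; y] i)^t* *m q = 0.
    by rewrite (on i (Ordinal (isT : 2 < 4)%N)) -val_eqE /= i2 raddf0.
  by rewrite (q0 0) ?(q0 1) ?(q0 3%:R) ?col_mx0.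
have id1 (v : 'cV[C]_4) : (v^T <= U^T)%MS -> orthoproj U *m v = 1 *: v.
  by move=> vU; rewrite (scale1r v); exact: (orthoproj_id vU).
have q0 : orthoproj U *m q = 0 *: q by rewrite (scale0r q); exact: (orthoproj_0 Uq).
move: (id1 _ xU) (id1 _ pU) (id1 _ yU) q0; move: (orthoproj U) => P *.
by case: a => [[|[|[|[|//]]]] ?].
Qed.

End TwoQubitSwap.

Lemma cplx_of_real (R : realType) (x : R) : cplx_of x \is Num.real.
Proof. by apply/complex_realP; exists x. Qed.

(** * Attractor space and asymptotics of the swap-type generator *)

Section SwapDynamics.
Context {R : realType}.
Local Notation C := (Cplx R).
Variables (E0 E1 phi : R) (j k : C).
Hypothesis k_neq0 : k != 0.
Local Notation e := (swap_basis phi).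
Local Notation on := (swap_basis_orthonormal phi).

Let H : 'M[C]_4 := hamiltonian E0 E1.
Let Ls : 'M[C]_4 := j%:M + k *: swap phi.
Let h (a : 'I_4) : C := cplx_of (level E0 E1 a).
Let l (a : 'I_4) : C := j + k * swap_sign a.
Let mu := lindblad_rate h l.

Let H_e a : H *m e a = h a *: e a.
Proof. exact: hamiltonian_swap_basis. Qed.

Let Ls_e a : Ls *m e a = l a *: e a.
Proof.
rewrite /Ls mulmxDl mul_scalar_mx -(scalemxAl k (swap phi)) swap_swap_basis.
by rewrite scalerA -scalerDl.
Qed.

Let h_real a : h a \is Num.real.
Proof. exact: cplx_of_real. Qed.

Let mu_kb a b : lindblad H Ls (kb e (a, b)) = mu a b *: kb e (a, b).
Proof. exact: (lindblad_kb on H_e Ls_e a b). Qed.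

Let block (a b : 'I_4) := (a == 2 :> nat) == (b == 2 :> nat).

(** The values of [l] are [j + k] and [j - k], distinct because [k] is nonzero. *)
Let l_eq a b : (l a == l b) = block a b.
Proof.
rewrite /l /block /swap_sign (can_eq (addKr _)) (can_eq (mulKf k_neq0)).
have N1 : (-1 == 1 :> C) = false by rewrite eqNr oner_eq0.
by case: (a == 2 :> nat); case: (b == 2 :> nat); rewrite ?eqxx ?N1 // eq_sym N1.
Qed.

Let Re_mu_eq0 a b : ('Re (mu a b) == 0) = block a b.
Proof.
rewrite /mu (Re_lindblad_rate l h_real) oppr_eq0 mulf_eq0 invr_eq0 pnatr_eq0 orbF.
by rewrite expf_eq0 /= normr_eq0 subr_eq0 l_eq.
Qed.

Let Re_mu_le0 a b : 'Re (mu a b) <= 0.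
Proof.
by rewrite /mu (Re_lindblad_rate l h_real) oppr_le0 divr_ge0 ?exprn_ge0.
Qed.

Let mu_block a b : block a b -> mu a b = - 'i * (h a - h b).
Proof. by rewrite -l_eq => /eqP lab; exact: (lindblad_rate_eq _ lab). Qed.

Let o0 : 'I_4 := Ordinal (isT : 0 < 4)%N.
Let o1 : 'I_4 := Ordinal (isT : 1 < 4)%N.
Let o2 : 'I_4 := Ordinal (isT : 2 < 4)%N.
Let o3 : 'I_4 := Ordinal (isT : 3 < 4)%N.
(** Ordered as the spanning list of the theorem, so that the two spans agree by conversion; index 2
    is [psi2]. *)
Let block_pairs : seq ('I_4 * 'I_4) :=
  [:: (o0, o0); (o1, o1); (o2, o2); (o3, o3); (o0, o1); (o1, o0); (o3, o1);
      (o1, o3); (o0, o3); (o3, o0)].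

Let block_pairsP a b : ((a, b) \in block_pairs) = ('Re (mu a b) == 0).
Proof.
rewrite Re_mu_eq0.
by case: a b => [[|[|[|[|//]]]] ?] [[|[|[|[|//]]]] ?].
Qed.

Lemma swap_attractor : attractor (lindblad H Ls) = <<map (kb e) block_pairs>>%VS.
Proof. exact: (attractor_diag on mu_kb block_pairsP). Qed.

Lemma dim_swap_attractor : \dim (attractor (lindblad H Ls)) = 10%N.
Proof.
have /eqP : free (map (kb e) block_pairs) by exact: (free_kb on (s := block_pairs)).
by rewrite swap_attractor => ->.
Qed.

Let PS : 'M[C]_4 := orthoproj (row_mx (ket 0 0) (row_mx (psi1 phi) (ket 1 1))).

Lemma swap_asymptotics (rho0 : 'M[C]_4) (rho_as : R -> 'M[C]_4) :
  asymptotic_dynamics (lindblad H Ls) rho0 rho_as <->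
  forall t : R, 0 <= t -> rho_as t =
    expmx ((- 'i * cplx_of t) *: H) *m PS *m rho0 *m PS
      *m expmx (('i * cplx_of t) *: H)
    + ((psi2 phi)^t* *m rho0 *m psi2 phi) 0 0 *: ketbra (psi2 phi) (psi2 phi).
Proof.
rewrite (asymptotic_dynamicsP on mu_kb Re_mu_le0).
have expH_e (c : C) a : expmx (c *: H) *m e a = cexp (c * h a) *: e a.
  rewrite (expmx_diag on (h := fun a => c * h a)) => [|b].
    rewrite mulmx_suml (bigD1 a) //= big1 => [|b ba].
      by rewrite -(scalemxAl _ (kb e (a, a))) (mul_kb on) eqxx scale1r addr0.
    by rewrite -(scalemxAl _ (kb e (b, b))) (mul_kb on) (negPf ba) scale0r scaler0.
  by rewrite -(scalemxAl c H) H_e scalerA.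
have PS_e a : PS *m e a = (a != 2 :> nat)%:R *: e a by exact: orthoproj_swap_basis.
pose P (a : 'I_4) : C := (a != 2 :> nat)%:R.
have formula t a b : mxcoef e a b (expmx ((- 'i * cplx_of t) *: H) *m PS *m rho0 *m PS
      *m expmx (('i * cplx_of t) *: H)
    + ((psi2 phi)^t* *m rho0 *m psi2 phi) 0 0 *: ketbra (psi2 phi) (psi2 phi)) =
    if 'Re (mu a b) == 0 then cexp (cplx_of t * mu a b) * mxcoef e a b rho0 else 0.
  rewrite -[ketbra (psi2 phi) _]/(kb e (o2, o2)) -[(_ *m _) 0 0]/(mxcoef e o2 o2 rho0).
  (* Grouping the right-hand [PS] with its exponential puts [rho0] between two operators diagonal in
     [e]. *)
  rewrite raddfD /= linearZ /= -(mulmxA _ PS (expmx _)).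
  rewrite (mxcoef_mul_diag on (al := fun a => cexp ((- 'i * cplx_of t) * h a) * P a)
    (be := fun a => cexp (('i * cplx_of t) * h a) * P a)); last 2 first.
  - by move=> c; rewrite -mulmxA PS_e -scalemxAr expH_e scalerA mulrC.
  - by move=> c; rewrite -mulmxA expH_e -scalemxAr PS_e scalerA.
  rewrite (mxcoef_kb on).
  have -> : ((o2, o2) == (a, b)) = (a == 2 :> nat) && (b == 2 :> nat).
    by rewrite xpair_eqE -!val_eqE /= ![2%N == _]eq_sym.
  rewrite Re_mu_eq0; have := @mu_block a b; rewrite /block /P.
  (* If both indices are 2 only the [psi2] term survives, with rate 0; if exactly one is, both sides
     vanish; otherwise the two exponentials combine into the phase of [mu a b]. *)
  case: (eqVneq (a : nat) 2%N) => a2; case: (eqVneq (b : nat) 2%N) => b2 /=.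
  - have -> : a = o2 by apply: val_inj.
    have -> : b = o2 by apply: val_inj.
    by move=> -> //; rewrite subrr !mulr0 cexp0 mul1r mul0r add0r mulr1.
  - by move=> _; rewrite !mulr0 !mul0r add0r.
  - by move=> _; rewrite !mulr0 mul0r add0r.
  move=> -> //; rewrite !mulr1 mulr0 addr0 -cexpD; congr (cexp _ * _); ring.
by split=> rhoE t t0; [apply: (mx_kbP on) => a b | move=> a b];
  rewrite (rhoE t t0) formula.
Qed.

End SwapDynamics.

Theorem mainTheorem7 (R : realType) (E0 E1 : R) (hE : E0 - E1 != 0)
    (phi : R) (hphi : 0 <= phi < 2 * pi) (j k : Cplx R) (hk : k != 0) :
  let H := hamiltonian E0 E1 in
  let Ls := j%:M + k *: swap phi in
  let LL := lindblad H Ls in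
  let k00 := ket 0 0 in
  let k11 := ket 1 1 in
  let p1 := psi1 phi in
  let p2 := psi2 phi in
  let PS := orthoproj (row_mx k00 (row_mx p1 k11)) in
  [/\ \dim (attractor LL) = 10%N,
      attractor LL =
        <<[:: ketbra k00 k00; ketbra p1 p1; ketbra p2 p2; ketbra k11 k11;
              ketbra k00 p1; ketbra p1 k00; ketbra k11 p1; ketbra p1 k11;
              ketbra k00 k11; ketbra k11 k00]>>%VS &
      forall rho0 : 'M[Cplx R]_4, density rho0 ->
      forall rho_as : R -> 'M[Cplx R]_4,
        asymptotic_dynamics LL rho0 rho_as <->
        forall t : R, 0 <= t ->
          rho_as t =
            expmx ((- 'i * cplx_of t) *: H) *m PS *m rho0 *m PS
              *m expmx (('i * cplx_of t) *: H)
            + (p2^t* *m rho0 *m p2) 0 0 *: ketbra p2 p2].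
Proof.
split.
- exact: dim_swap_attractor.
- exact: swap_attractor.
- by move=> rho0 _ rho_as; exact: swap_asymptotics.
Qed.
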